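(* Let $r\in\mathbb{N}$, $x\in\mathbb{C}$, and $\lambda\in\mathbb{C}$ with $|\lambda|<1$. Then $$\sum_{n=0}^{\infty}\Phi^{B,r}_{M,\lambda}(-n,x)\frac{t^n}{M_n!}=\frac{e_M^{xt}}{(1-\lambda e_M^t)^r}$$ for all complex $t$ in a neighborhood of $0$ on which $|\lambda e_M^t|<1$ (that is, there is a neighborhood $U$ of $0$ in $\mathbb{C}$ such that for every $t\in U$ one has $|\lambda e_M^t|<1$ and the identity holds).
   Context: $\mathbb{N}=\{1,2,\ldots\}$, $\mathbb{N}_0=\{0,1,2,\ldots\}$. For $n\ge 0$, $M_n=2^n-1$. The M-factorial is $M_0!=1$ and $M_n!=M_nM_{n-1}\cdots M_1$ for $n\geq 1$. The M-exponential is $e_M^{xt}=\sum_{n=0}^{\infty}\frac{x^nt^n}{M_n!}$, and $e_M^t$ denotes the case $x=1$. For $m\in\mathbb{N}_0$ the Mersenne translation polynomials $P_{n,M}(x;m)$ are defined by $e_M^{xt}\left(e_M^t\right)^m=\sum_{n=0}^{\infty}P_{n,M}(x;m)\frac{t^n}{M_n!}$, where $(e_M^t)^m$ is the ordinary $m$-fold product. For $r\in\mathbb{N}$, $n\in\mathbb{N}_0$, $x\in\mathbb{C}$ and $|\lambda|<1$, the Bernoulli-type Mersenne-Lerch interpolation value of order $r$ at $-n$ is the (convergent) series $\Phi^{B,r}_{M,\lambda}(-n,x)=\sum_{m=0}^{\infty}\binom{m+r-1}{m}\lambda^mP_{n,M}(x;m)$, where $\binom{m+r-1}{m}$ is the ordinary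 binomial coefficient and $\lambda^0=1$. *)

(* Defs.v *)
From Stdlib Require Import Reals Lra Lia Arith.
From Coquelicot Require Import Coquelicot.

Open Scope R_scope.
Open Scope C_scope.

Definition mersenne (n : nat) : nat := (2 ^ n - 1)%nat.

Fixpoint Mfact (n : nat) : nat :=
  match n with
  | O => 1%nat
  | S k => (mersenne (S k) * Mfact k)%nat
  end.

Definition CMfact (n : nat) : C := RtoC (INR (Mfact n)).

(* Coquelicot's [Series] is real-valued only.  As for its [RInt], this total
   operator is meaningful when the series converges. *)
Definition CSeries (a : nat -> C) : C :=
  @iota C_CompleteNormedModule
    (fun l : C => @is_series C_AbsRing C_NormedModule a l).

(* [e_M x t] is the M-exponential written e_M^{xt}. *)
Definition e_M (x t : C) : C :=
  CSeries (fun n => x ^ n * t ^ n / CMfact n).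

(* Formal power series in t, represented by their coefficient sequences. *)
Definition fps_mult (a b : nat -> C) (n : nat) : C :=
  @sum_n C_AbelianMonoid (fun k => a k * b (n - k)%nat) n.

Fixpoint fps_pow (a : nat -> C) (m : nat) : nat -> C :=
  match m with
  | O => fun n => match n with O => RtoC 1 | S _ => RtoC 0 end
  | S p => fps_mult a (fps_pow a p)
  end.

Definition e_M_coef (x : C) (n : nat) : C := x ^ n / CMfact n.

(* P_{n,M}(x;m): the coefficient of t^n / M_n! in e_M^{xt} (e_M^t)^m.
   See [trans_poly_generating] for the corresponding identity of convergent
   series. *)
Definition trans_poly (n m : nat) (x : C) : C :=
  CMfact n * fps_mult (e_M_coef x) (fps_pow (e_M_coef 1) m) n.

(* Phi^{B,r}_{M,lambda}(-n,x).  [Binomial.C] is the real-valued binomial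
   coefficient; the subtraction in nat is exact for r >= 1. *)
Definition Phi_term (r : nat) (lambda : C) (n : nat) (x : C) (m : nat) : C :=
  RtoC (Binomial.C (m + r - 1) m) * lambda ^ m * trans_poly n m x.

Definition Phi (r : nat) (lambda : C) (n : nat) (x : C) : C :=
  CSeries (Phi_term r lambda n x).

Notation C_is_series := (@is_series C_AbsRing C_NormedModule).
Notation C_ex_series := (@ex_series C_AbsRing C_NormedModule).

Lemma CSeries_unique (a : nat -> C) (l : C) : C_is_series a l -> CSeries a = l.
Proof.
intros H. unfold CSeries.
apply (@iota_filterlim_locally C_AbsRing C_CompleteNormedModule nat eventually _
  (@sum_n C_AbelianMonoid a) l H).
Qed.

Lemma CSeries_correct (a : nat -> C) : C_ex_series a -> C_is_series a (CSeries a).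
Proof. intros [l H]. now rewrite (CSeries_unique a l H). Qed.

Lemma fst_sum_n (a : nat -> C) n :
  fst (@sum_n C_AbelianMonoid a n) = sum_n (fun k => fst (a k)) n.
Proof.
induction n as [|n IH]; [now rewrite !sum_O|].
rewrite !sum_Sn, <- IH. reflexivity.
Qed.

Lemma snd_sum_n (a : nat -> C) n :
  snd (@sum_n C_AbelianMonoid a n) = sum_n (fun k => snd (a k)) n.
Proof.
induction n as [|n IH]; [now rewrite !sum_O|].
rewrite !sum_Sn, <- IH. reflexivity.
Qed.

Lemma C_is_series_parts (a : nat -> C) (l : C) :
  C_is_series a l <->
  is_series (fun n => fst (a n)) (fst l) /\ is_series (fun n => snd (a n)) (snd l).
Proof.
split.
- intros H. split; intros P [e He].
  + assert (K := H (fun z => P (fst z))). unfold filtermap in K.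
    destruct K as [N HN].
    { exists e. intros z [Hz _]. now apply He. }
    exists N. intros n Hn. specialize (HN n Hn). now rewrite <- fst_sum_n.
  + assert (K := H (fun z => P (snd z))). unfold filtermap in K.
    destruct K as [N HN].
    { exists e. intros z [_ Hz]. now apply He. }
    exists N. intros n Hn. specialize (HN n Hn). now rewrite <- snd_sum_n.
- intros [H1 H2] P [e He].
  destruct (H1 (ball (fst l) e)) as [N1 K1]; [now exists e|].
  destruct (H2 (ball (snd l) e)) as [N2 K2]; [now exists e|].
  exists (max N1 N2). intros n Hn. apply He. split.
  + rewrite fst_sum_n. apply K1. lia.
  + rewrite snd_sum_n. apply K2. lia.
Qed.

Lemma ex_series_dom (a b : nat -> R) :
  (forall n, Rabs (a n) <= b n)%R -> ex_series b -> ex_series a.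
Proof. intros H. now apply (@ex_series_le R_AbsRing R_CompleteNormedModule). Qed.

Lemma C_ex_series_dom (a : nat -> C) (b : nat -> R) :
  (forall n, Cmod (a n) <= b n)%R -> ex_series b -> C_ex_series a.
Proof.
intros H. apply (@ex_series_le C_AbsRing C_CompleteNormedModule).
intros n. unfold norm; simpl. apply H.
Qed.

Lemma fst_le_Cmod z : (Rabs (fst z) <= Cmod z)%R.
Proof. eapply Rle_trans; [apply Rmax_l|apply Rmax_Cmod]. Qed.

Lemma snd_le_Cmod z : (Rabs (snd z) <= Cmod z)%R.
Proof. eapply Rle_trans; [apply Rmax_r|apply Rmax_Cmod]. Qed.

Lemma Cmod_sum_n (a : nat -> C) n :
  (Cmod (@sum_n C_AbelianMonoid a n) <= sum_n (fun k => Cmod (a k)) n)%R.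
Proof.
induction n as [|n IH]; [rewrite !sum_O; lra|].
rewrite !sum_Sn. eapply Rle_trans; [apply Cmod_triangle|].
unfold plus; simpl. lra.
Qed.

Lemma sum_n_le_R (a b : nat -> R) n :
  (forall k, (k <= n)%nat -> a k <= b k)%R -> (sum_n a n <= sum_n b n)%R.
Proof.
intros H. induction n as [|n IH]; [rewrite !sum_O; apply H; lia|].
rewrite !sum_Sn. apply Rplus_le_compat; [apply IH; intros; apply H; lia|apply H; lia].
Qed.

(* Cauchy products of absolutely convergent complex series. *)
Lemma fps_mult_abs (a b : nat -> C) :
  ex_series (fun n => Cmod (a n)) -> ex_series (fun n => Cmod (b n)) ->
  ex_series (fun n => Cmod (fps_mult a b n)).
Proof.
intros [la Ha] [lb Hb].
apply ex_series_dom with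
  (fun n => sum_f_R0 (fun k => Cmod (a k) * Cmod (b (n - k)%nat))%R n).
- intros n. rewrite Rabs_pos_eq by apply Cmod_ge_0.
  rewrite <- sum_n_Reals. eapply Rle_trans; [apply Cmod_sum_n|].
  apply sum_n_le_R. intros k _. rewrite Cmod_mult. lra.
- exists (la * lb)%R.
  apply (is_series_mult (fun k => Cmod (a k)) (fun k => Cmod (b k))); trivial.
  + exists la. eapply is_series_ext; [|exact Ha].
    intros n; simpl. now rewrite Rabs_pos_eq by apply Cmod_ge_0.
  + exists lb. eapply is_series_ext; [|exact Hb].
    intros n; simpl. now rewrite Rabs_pos_eq by apply Cmod_ge_0.
Qed.

Lemma sum_n_plus_R (a b : nat -> R) n :
  (sum_n (fun k => a k + b k) n = sum_n a n + sum_n b n)%R.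
Proof. apply (@sum_n_plus R_AbelianMonoid). Qed.

Lemma sum_n_opp_R (a : nat -> R) n :
  (sum_n (fun k => - a k) n = - sum_n a n)%R.
Proof.
induction n as [|n IH]; [now rewrite !sum_O|].
rewrite !sum_Sn, IH. unfold plus; simpl. ring.
Qed.

Lemma fps_mult_series (a b : nat -> C) (la lb : C) :
  ex_series (fun n => Cmod (a n)) -> ex_series (fun n => Cmod (b n)) ->
  C_is_series a la -> C_is_series b lb ->
  C_is_series (fps_mult a b) (la * lb).
Proof.
intros Aa Ab Ha Hb.
apply C_is_series_parts in Ha. destruct Ha as [Ha1 Ha2].
apply C_is_series_parts in Hb. destruct Hb as [Hb1 Hb2].
assert (A1 : ex_series (fun n => Rabs (fst (a n)))).
{ apply ex_series_dom with (2 := Aa). intros n. rewrite Rabs_Rabsolu. apply fst_le_Cmod. }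
assert (A2 : ex_series (fun n => Rabs (snd (a n)))).
{ apply ex_series_dom with (2 := Aa). intros n. rewrite Rabs_Rabsolu. apply snd_le_Cmod. }
assert (B1 : ex_series (fun n => Rabs (fst (b n)))).
{ apply ex_series_dom with (2 := Ab). intros n. rewrite Rabs_Rabsolu. apply fst_le_Cmod. }
assert (B2 : ex_series (fun n => Rabs (snd (b n)))).
{ apply ex_series_dom with (2 := Ab). intros n. rewrite Rabs_Rabsolu. apply snd_le_Cmod. }
assert (M11 := is_series_mult _ _ _ _ Ha1 Hb1 A1 B1).
assert (M12 := is_series_mult _ _ _ _ Ha1 Hb2 A1 B2).
assert (M21 := is_series_mult _ _ _ _ Ha2 Hb1 A2 B1).
assert (M22 := is_series_mult _ _ _ _ Ha2 Hb2 A2 B2).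
apply C_is_series_parts. split.
- eapply is_series_ext; [|apply (is_series_minus _ _ _ _ M11 M22)].
  intros n. unfold fps_mult. rewrite fst_sum_n. simpl.
  rewrite <- !sum_n_Reals. unfold plus, opp; simpl.
  rewrite <- sum_n_opp_R, <- sum_n_plus_R. reflexivity.
- eapply is_series_ext; [|apply (is_series_plus _ _ _ _ M12 M21)].
  intros n. unfold fps_mult. rewrite snd_sum_n. simpl.
  rewrite <- !sum_n_Reals. unfold plus; simpl.
  rewrite <- sum_n_plus_R. reflexivity.
Qed.

Lemma mersenne_ge n : (n <= mersenne n)%nat.
Proof. unfold mersenne. pose proof (Nat.pow_gt_lin_r 2 n). lia. Qed.

Lemma Mfact_ge n : (fact n <= Mfact n)%nat.
Proof.
induction n as [|n IH]; [reflexivity|].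
change (S n * fact n <= mersenne (S n) * Mfact n)%nat.
apply Nat.mul_le_mono; trivial. apply mersenne_ge.
Qed.

Lemma INR_fact_le n : (0 < INR (fact n) <= INR (Mfact n))%R.
Proof. split; [apply INR_fact_lt_0|apply le_INR, Mfact_ge]. Qed.

Lemma CMfact_neq0 n : CMfact n <> RtoC 0.
Proof.
intros H. apply RtoC_inj in H. pose proof (INR_fact_le n). lra.
Qed.

Lemma Cmod_e_M_coef x n : (Cmod (e_M_coef x n) <= Cmod x ^ n * / INR (fact n))%R.
Proof.
unfold e_M_coef. rewrite Cmod_div by apply CMfact_neq0.
rewrite Cmod_pow. unfold CMfact. pose proof (INR_fact_le n).
rewrite Cmod_R, Rabs_pos_eq by lra.
apply Rmult_le_compat_l; [apply pow_le, Cmod_ge_0|].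
apply Rinv_le_contravar; lra.
Qed.

Lemma e_M_coef_abs x t : ex_series (fun n => Cmod (e_M_coef x n * t ^ n)).
Proof.
apply ex_series_dom with (fun n => (Cmod x * Cmod t) ^ n * / INR (fact n))%R.
- intros n. rewrite Rabs_pos_eq by apply Cmod_ge_0.
  rewrite Cmod_mult, Cmod_pow, Rpow_mult_distr.
  pose proof (Cmod_e_M_coef x n).
  apply Rle_trans with (Cmod x ^ n * / INR (fact n) * Cmod t ^ n)%R; [|lra].
  apply Rmult_le_compat_r; trivial. apply pow_le, Cmod_ge_0.
- pose proof (is_exp_Reals (Cmod x * Cmod t)) as H.
  exists (exp (Cmod x * Cmod t)). eapply is_series_ext; [|exact H].
  intros n. simpl. rewrite pow_n_pow. unfold scal; simpl. reflexivity.
Qed.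

Lemma e_M_is_series x t : C_is_series (fun n => e_M_coef x n * t ^ n) (e_M x t).
Proof.
unfold e_M.
assert (E : C_ex_series (fun n => e_M_coef x n * t ^ n)).
{ apply C_ex_series_dom with (2 := e_M_coef_abs x t). intros; lra. }
destruct E as [l Hl].
rewrite (CSeries_unique _ l); trivial.
eapply is_series_ext; [|exact Hl]. intros n; simpl. unfold e_M_coef, Cdiv. ring.
Qed.

Lemma fps_mult_scale (a b : nat -> C) t n :
  fps_mult a b n * t ^ n = fps_mult (fun k => a k * t ^ k) (fun k => b k * t ^ k) n.
Proof.
unfold fps_mult.
rewrite <- (@sum_n_mult_r C_Ring).
apply sum_n_ext_loc. intros k Hk. unfold mult; simpl.
replace (t ^ n) with (t ^ k * t ^ (n - k)); [ring|].
rewrite <- Cpow_add_r. f_equal. lia.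
Qed.

Lemma fps_pow_series t m :
  ex_series (fun n => Cmod (fps_pow (e_M_coef 1) m n * t ^ n)) /\
  C_is_series (fun n => fps_pow (e_M_coef 1) m n * t ^ n) (e_M 1 t ^ m).
Proof.
induction m as [|m [IH1 IH2]].
- assert (H : C_is_series (fun n => fps_pow (e_M_coef 1) 0 n * t ^ n) (RtoC 1)).
  { apply is_series_decr_1.
    replace (plus _ _) with (@zero C_AbelianGroup).
    - intros P HP. exists 0%nat. intros n _.
      replace (sum_n _ n) with (@zero C_AbelianGroup).
      + exact (@locally_singleton C_UniformSpace (RtoC 0) P HP).
      + induction n as [|n IH]; [rewrite sum_O|rewrite sum_Sn, <- IH];
          simpl; unfold plus, zero; simpl; ring.
    - simpl. unfold plus, opp, zero; simpl. ring. }
  split; [|exact H].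
  apply ex_series_ext with (fun n => match n with O => 1 | S _ => 0 end)%R.
  + intros [|n]; simpl.
    * now rewrite Cmult_1_r, Cmod_1.
    * now rewrite Cmult_0_l, Cmod_0.
  + exists 1%R. apply C_is_series_parts in H. destruct H as [H _].
    eapply is_series_ext; [|exact H]. intros [|n]; simpl; ring.
- split.
  + eapply ex_series_ext; [|apply (fps_mult_abs _ _ (e_M_coef_abs 1 t) IH1)].
    intros n. simpl. now rewrite fps_mult_scale.
  + eapply is_series_ext;
      [|apply (fps_mult_series _ _ _ _ (e_M_coef_abs 1 t) IH1 (e_M_is_series 1 t) IH2)].
    intros n. simpl. now rewrite fps_mult_scale.
Qed.

Lemma trans_poly_generating (x t : C) (m : nat) :
  C_is_series (fun n => trans_poly n m x * t ^ n / CMfact n) (e_M x t * e_M 1 t ^ m).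
Proof.
destruct (fps_pow_series t m) as [H1 H2].
eapply is_series_ext;
  [|apply (fps_mult_series _ _ _ _ (e_M_coef_abs x t) H1 (e_M_is_series x t) H2)].
intros n. simpl. rewrite <- fps_mult_scale. unfold trans_poly.
field. apply CMfact_neq0.
Qed.

Lemma sum_pow_le (c : R) n :
  (1 <= c -> sum_n (fun k => c ^ k) n <= (c + 1) ^ n)%R.
Proof.
intros Hc. induction n as [|n IH]; [rewrite sum_O; simpl; lra|].
rewrite sum_Sn. unfold plus; simpl.
assert (c ^ n <= (c + 1) ^ n)%R by (apply pow_incr; lra).
assert (c * c ^ n <= c * (c + 1) ^ n)%R by (apply Rmult_le_compat_l; lra).
lra.
Qed.

Lemma sum_n_rev (a : nat -> R) n : sum_n (fun k => a (n - k)%nat) n = sum_n a n.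
Proof.
rewrite !sum_n_Reals. apply eq_sym.
revert a; induction n as [|n IH]; intros a; [reflexivity|].
rewrite decomp_sum by lia. simpl pred. rewrite (IH (fun i => a (S i))).
rewrite tech5, Nat.sub_diag, Rplus_comm. f_equal.
apply sum_eq. intros i Hi. f_equal. lia.
Qed.

Lemma Cmod_e_M_coef_le x n : (Cmod (e_M_coef x n) <= (1 + Cmod x) ^ n)%R.
Proof.
pose proof (Cmod_ge_0 x).
eapply Rle_trans; [apply Cmod_e_M_coef|].
assert (Cmod x ^ n <= (1 + Cmod x) ^ n)%R by (apply pow_incr; lra).
assert (0 <= Cmod x ^ n)%R by (apply pow_le; lra).
assert (/ INR (fact n) <= 1)%R.
{ rewrite <- Rinv_1. apply Rinv_le_contravar; [lra|].
  apply (le_INR 1). pose proof (lt_O_fact n). lia. }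
assert (Cmod x ^ n * / INR (fact n) <= Cmod x ^ n * 1)%R
  by (apply Rmult_le_compat_l; lra).
lra.
Qed.

Lemma Cmod_e_M_coef_1 n : (Cmod (e_M_coef 1 n) <= 1)%R.
Proof.
eapply Rle_trans; [apply Cmod_e_M_coef|].
rewrite Cmod_1, pow1, Rmult_1_l, <- Rinv_1. apply Rinv_le_contravar; [lra|].
apply (le_INR 1). pose proof (lt_O_fact n). lia.
Qed.

Lemma Cmod_fps_pow m n :
  (Cmod (fps_pow (e_M_coef 1) m n) <= INR (S m) ^ n)%R.
Proof.
revert n; induction m as [|m IH]; intros n.
- change (INR 1) with 1%R. rewrite pow1. destruct n; simpl.
  + rewrite Cmod_1; lra.
  + rewrite Cmod_0; lra.
- change (Cmod (fps_mult (e_M_coef 1) (fps_pow (e_M_coef 1) m) n)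
          <= INR (S (S m)) ^ n)%R.
  unfold fps_mult. eapply Rle_trans; [apply Cmod_sum_n|].
  apply Rle_trans with (sum_n (fun k => INR (S m) ^ (n - k)) n)%R.
  + apply sum_n_le_R. intros k _. rewrite Cmod_mult.
    pose proof (Cmod_e_M_coef_1 k). pose proof (IH (n - k)%nat).
    pose proof (Cmod_ge_0 (e_M_coef 1 k)).
    pose proof (Cmod_ge_0 (fps_pow (e_M_coef 1) m (n - k))).
    rewrite <- (Rmult_1_l (INR (S m) ^ (n - k))).
    apply Rmult_le_compat; trivial.
  + rewrite (sum_n_rev (fun k => INR (S m) ^ k)%R n), (S_INR (S m)).
    apply sum_pow_le. apply (le_INR 1). lia.
Qed.

Lemma Cmod_trans_poly n x :
  exists K : R, forall m, (Cmod (trans_poly n m x) <= K * INR (S m) ^ n)%R.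
Proof.
exists (INR (Mfact n) * (INR (S n) * (1 + Cmod x) ^ n))%R. intros m.
unfold trans_poly. rewrite Cmod_mult. unfold CMfact.
rewrite Cmod_R, Rabs_pos_eq by apply pos_INR.
rewrite Rmult_assoc. apply Rmult_le_compat_l; [apply pos_INR|].
unfold fps_mult. eapply Rle_trans; [apply Cmod_sum_n|].
apply Rle_trans with (sum_n (fun _ => (1 + Cmod x) ^ n * INR (S m) ^ n) n)%R.
- apply sum_n_le_R. intros k Hk. rewrite Cmod_mult.
  pose proof (Cmod_ge_0 x).
  apply Rmult_le_compat; try apply Cmod_ge_0.
  + eapply Rle_trans; [apply Cmod_e_M_coef_le|]. apply Rle_pow; [lra|lia].
  + eapply Rle_trans; [apply Cmod_fps_pow|]. apply Rle_pow; [|lia].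
    apply (le_INR 1). lia.
- rewrite sum_n_const. lra.
Qed.

Lemma binom_le r m : (0 <= Binomial.C (m + r) m <= INR (S m) ^ r)%R.
Proof.
assert (P : forall r, (0 <= Binomial.C (m + r) m)%R).
{ intros s. unfold Binomial.C. apply Rlt_le, Rdiv_lt_0_compat;
    [|apply Rmult_lt_0_compat]; apply INR_fact_lt_0. }
split; [apply P|].
induction r as [|r IH].
- rewrite Nat.add_0_r. unfold Binomial.C. rewrite Nat.sub_diag. simpl.
  apply Req_le. field. apply INR_fact_neq_0.
- assert (E : (Binomial.C (m + S r) m
     = Binomial.C (m + r) m * (INR (m + S r) / INR (S r)))%R).
  { unfold Binomial.C.
    replace (m + S r - m)%nat with (S r) by lia.
    replace (m + r - m)%nat with r by lia.
    replace (m + S r)%nat with (S (m + r)) by lia.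
    rewrite !fact_simpl, !mult_INR. field.
    repeat split; try apply INR_fact_neq_0. apply not_0_INR; lia. }
  rewrite E. simpl pow. rewrite (Rmult_comm (INR (S m))).
  assert (0 < INR (S r))%R by (apply lt_0_INR; lia).
  apply Rmult_le_compat; trivial.
  + apply Rlt_le, Rdiv_lt_0_compat; trivial. apply lt_0_INR; lia.
  + apply Rmult_le_reg_r with (INR (S r)); trivial.
    unfold Rdiv. rewrite Rmult_assoc, Rinv_l, Rmult_1_r by lra.
    rewrite <- mult_INR. apply le_INR. nia.
Qed.

Lemma ex_series_pow_geom (k : nat) (q : R) :
  (0 < q < 1)%R -> ex_series (fun m => INR (S m) ^ k * q ^ m)%R.
Proof.
intros Hq.
assert (Hp : forall m, (0 < INR (S m))%R) by (intros; apply lt_0_INR; lia).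
assert (N0 : forall m, (INR (S m) ^ k * q ^ m <> 0)%R).
{ intros m. apply Rmult_integral_contrapositive_currified; apply pow_nonzero.
  - pose proof (Hp m); lra.
  - lra. }
apply ex_series_dom with (fun m => Rabs (INR (S m) ^ k * q ^ m))%R; [intros; lra|].
apply ex_series_DAlembert with q; try lra; trivial.
apply is_lim_seq_ext with (fun m => (1 + / INR (S m)) ^ k * q)%R.
{ intros m. rewrite Rabs_pos_eq.
  - rewrite (S_INR (S m)).
    replace (1 + / INR (S m))%R with ((INR (S m) + 1) * / INR (S m))%R.
    + rewrite Rpow_mult_distr, pow_inv. change (q ^ S m)%R with (q * q ^ m)%R.
      pose proof (Hp m). field. split; apply pow_nonzero; lra.
    + field. pose proof (Hp m); lra.
  - apply Rlt_le, Rdiv_lt_0_compat; apply Rmult_lt_0_compat; apply pow_lt; trivial; lra. }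
replace (Finite q) with (Finite (1 ^ k * q)) by (now rewrite pow1, Rmult_1_l).
apply is_lim_seq_mult'; [|apply is_lim_seq_const].
assert (L : is_lim_seq (fun m => 1 + / INR (S m))%R 1).
{ replace (Finite 1) with (Finite (1 + 0)) by (f_equal; lra).
  apply is_lim_seq_plus'; [apply is_lim_seq_const|].
  apply (is_lim_seq_incr_1 (fun n => / INR n)%R).
  replace (Finite 0) with (Rbar_inv p_infty) by reflexivity.
  apply is_lim_seq_inv; [apply is_lim_seq_INR|discriminate]. }
clear -L. induction k as [|k IH]; [apply is_lim_seq_const|].
simpl. now apply is_lim_seq_mult'.
Qed.

Lemma Phi_ex_series (r : nat) (lambda : C) (n : nat) (x : C) :
  (1 <= r)%nat -> (Cmod lambda < 1)%R -> C_ex_series (Phi_term r lambda n x).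
Proof.
intros Hr Hl. pose proof (Cmod_ge_0 lambda) as Hl0.
destruct (Cmod_trans_poly n x) as [K HK].
set (q := ((1 + Cmod lambda) / 2)%R).
apply C_ex_series_dom with (fun m => K * (INR (S m) ^ (r - 1 + n) * q ^ m))%R.
- intros m. unfold Phi_term. rewrite !Cmod_mult, Cmod_pow.
  replace (m + r - 1)%nat with (m + (r - 1))%nat by lia.
  destruct (binom_le (r - 1) m) as [B0 B1].
  rewrite Cmod_R, Rabs_pos_eq by exact B0.
  apply Rle_trans with (INR (S m) ^ (r - 1) * q ^ m * (K * INR (S m) ^ n))%R.
  + assert (L0 : (0 <= Cmod lambda ^ m)%R) by now apply pow_le.
    apply Rmult_le_compat; try apply Cmod_ge_0; [|..].
    * now apply Rmult_le_pos.
    * apply Rmult_le_compat; trivial. apply pow_incr. unfold q; lra.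
    * apply HK.
  + rewrite pow_add. apply Req_le. ring.
- apply (@ex_series_scal_l R_AbsRing) with (c := K).
  apply ex_series_pow_geom. unfold q; lra.
Qed.

(* Main.v *)
Require Import Defs.
From Stdlib Require Import Reals Arith Lra Lia.
From Coquelicot Require Import Coquelicot.

(** Write [E] for [e_M^t].  Both sides of the identity are sums of one double
    series, whose entry in row [m] and column [n] is

      binom(m+r-1, m) lambda^m P_{n,M}(x;m) t^n / M_n!.

    Row [m] sums to [binom(m+r-1, m) (lambda E)^m e_M^{xt}] by
    [trans_poly_generating], and these row sums add up to
    [e_M^{xt} / (1 - lambda E)^r] by [negative_binomial_series].  Column [n]
    sums to [Phi(-n,x) t^n / M_n!] by the definition of [Phi], whose series
    converges by [Phi_ex_series].

    The two orders of summation agree because the double series converges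
    absolutely ([double_series_swap]).  As [M_n! >= 1], the coefficients of
    [e_M^t] have absolute values summing to at most [B = 1/(1-|t|)] when
    [|t| < 1].  Cauchy products are submultiplicative for this sum of absolute
    values, so row [m] has absolute sum at most
    [A binom(m+r-1, m) (|lambda| B)^m] with [A] independent of [m]
    ([sum_Cmod_trans_poly_le]).  This is summable in [m] as soon as
    [|lambda| B < 1], which means [|t| < 1 - |lambda|].  That disc is the
    neighbourhood; on it [|lambda E| <= |lambda| B < 1] as well. *)

Open Scope R_scope.

(** * Dominated series and interchange of summation *)

Lemma norm_series_le {K : AbsRing} {V : NormedModule K}
    (a : nat -> V) (b : nat -> R) (la : V) (lb : R) :
  (forall n, norm (a n) <= b n) -> is_series a la -> is_series b lb ->
  norm la <= lb.
Proof.
intros Hab Ha Hb.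
apply (@filterlim_le nat eventually _
         (fun n => norm (sum_n a n)) (sum_n b) (norm la) lb).
- exists 0%nat. intros n _. unfold sum_n.
  eapply Rle_trans; [apply norm_sum_n_m|]. now apply sum_n_m_le.
- apply (filterlim_comp _ _ _ (sum_n a) norm _ (locally la)); [exact Ha|].
  apply filterlim_norm.
- exact Hb.
Qed.

(** Apply the previous bound to the series started at index [N + 1]. *)
Lemma norm_series_tail_le {K : AbsRing} {V : NormedModule K}
    (a : nat -> V) (b : nat -> R) (la : V) (lb : R) (N : nat) :
  (forall n, norm (a n) <= b n) -> is_series a la -> is_series b lb ->
  norm (minus la (sum_n a N)) <= lb - sum_n b N.
Proof.
intros Hab Ha Hb.
apply (norm_series_le (fun k => a (S N + k)%nat) (fun k => b (S N + k)%nat)).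
- intros k; apply Hab.
- apply is_series_incr_n; [lia|]. simpl pred.
  refine (eq_ind_r (is_series a) Ha _).
  unfold minus. rewrite <- plus_assoc.
  etransitivity; [exact (f_equal (plus la) (plus_opp_l (sum_n a N)))|apply plus_zero_r].
- apply (@is_series_incr_n R_AbsRing R_NormedModule); [lia|]. simpl pred.
  refine (eq_ind_r (is_series b) Hb _).
  change (lb - sum_n b N + sum_n b N = lb). ring.
Qed.

(** The Weierstrass M-test, in the filter form needed to exchange limits. *)
Lemma weierstrass_M_test {T : Type} {K : AbsRing} {V : NormedModule K}
    (f : nat -> T -> V) (s : T -> V) (b : nat -> R) :
  (forall m x, norm (f m x) <= b m) -> ex_series b ->
  (forall x, is_series (fun m => f m x) (s x)) ->
  filterlim (fun M x => sum_n (fun m => f m x) M) eventually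
    (@locally (fct_UniformSpace T V) s).
Proof.
intros Hb [lb Hlb] Hs.
apply (proj2 (@filterlim_locally nat (fct_UniformSpace T V) _ _ _ _)). intros eps.
destruct (proj1 (filterlim_locally (sum_n b) lb) Hlb eps) as [N HN].
exists N. intros M HM x.
apply ball_sym, norm_compat1.
eapply Rle_lt_trans.
- apply (norm_series_tail_le (fun m => f m x) b _ lb M); trivial.
- specialize (HN M HM). apply ball_sym in HN.
  unfold ball in HN; simpl in HN.
  unfold AbsRing_ball, abs, minus, plus, opp in HN; simpl in HN.
  eapply Rle_lt_trans; [apply Rle_abs|exact HN].
Qed.

Lemma is_series_sum_n {K : AbsRing} {V : NormedModule K}
    (a : nat -> nat -> V) (h : nat -> V) (N : nat) :
  (forall n, is_series (fun m => a m n) (h n)) ->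
  is_series (fun m => sum_n (a m) N) (sum_n h N).
Proof.
intros H. induction N as [|N IH].
- rewrite sum_O. eapply is_series_ext; [|apply (H 0%nat)].
  intros m. now rewrite sum_O.
- rewrite sum_Sn.
  eapply is_series_ext; [|apply (is_series_plus _ _ _ _ IH (H (S N)))].
  intros m. now rewrite sum_Sn.
Qed.

(** The partial row sums [sum_n (a m) N], summed over [m], converge uniformly
    in [N] by the M-test, so the limits in [m] and in [N] can be exchanged. *)
Lemma double_series_swap {K : AbsRing} {V : CompleteNormedModule K}
    (a : nat -> nat -> V) (b : nat -> R) (row col : nat -> V) (l : V) :
  (forall m N, sum_n (fun n => norm (a m n)) N <= b m) -> ex_series b ->
  (forall m, is_series (a m) (row m)) ->
  (forall n, is_series (fun m => a m n) (col n)) ->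
  is_series row l -> is_series col l.
Proof.
intros Hb Eb Hrow Hcol Hl.
assert (U : filterlim (fun M N => sum_n (fun m => sum_n (a m) N) M) eventually
              (@locally (fct_UniformSpace nat V) (sum_n col))).
{ apply (weierstrass_M_test (fun m N => sum_n (a m) N) (sum_n col) b); trivial.
  - intros m N. eapply Rle_trans; [exact (norm_sum_n_m (V := V) (a m) 0 N)|apply Hb].
  - intros N. exact (is_series_sum_n (V := V) a col N Hcol). }
destruct (filterlim_switch eventually _ eventually _ _ _ (sum_n row) U)
  as [l' [H1 H2]].
(* For fixed [M] the limit in [N] is that of finitely many rows. *)
- intros M.
  assert (S : is_series (fun n => sum_n (fun m => a m n) M) (sum_n row M))
    by exact (is_series_sum_n (V := V) (fun n m => a m n) row M Hrow).
  eapply filterlim_ext; [|exact S].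
  intros N. simpl. apply sum_n_switch.
- now rewrite (filterlim_locally_unique _ _ _ Hl H1).
Qed.

Lemma sum_n_le_series (a : nat -> R) (l : R) :
  (forall n, 0 <= a n) -> is_series a l -> forall N, sum_n a N <= l.
Proof.
intros Ha Hl. apply (is_lim_seq_incr_compare _ _ Hl).
intros n. rewrite sum_Sn. unfold plus; simpl. specialize (Ha (S n)). lra.
Qed.

(** The sum over the triangle [i + j <= N] is part of that over the square. *)
Lemma sum_Cmod_fps_mult_le (a b : nat -> C) (A B : R) :
  (forall N, sum_n (fun n => Cmod (a n)) N <= A) ->
  (forall N, sum_n (fun n => Cmod (b n)) N <= B) ->
  forall N, sum_n (fun n => Cmod (fps_mult a b n)) N <= A * B.
Proof.
intros HA HB N.
assert (P : forall c : nat -> C, 0 <= sum_n (fun n => Cmod (c n)) N).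
{ intros c. rewrite sum_n_Reals. apply cond_pos_sum. intros; apply Cmod_ge_0. }
apply Rle_trans with
  (sum_n (fun n => Cmod (a n)) N * sum_n (fun n => Cmod (b n)) N);
  [|now apply Rmult_le_compat].
apply Rle_trans with
  (sum_n (fun n => sum_n (fun k => Cmod (a k) * Cmod (b (n - k)%nat)) n) N).
- apply sum_n_le_R. intros n _.
  unfold fps_mult. eapply Rle_trans; [apply Cmod_sum_n|].
  apply sum_n_le_R. intros k _. rewrite Cmod_mult. lra.
- destruct N as [|N]; [rewrite !sum_O; simpl; lra|].
  rewrite !sum_n_Reals, cauchy_finite by lia.
  match goal with |- ?L <= ?L' + ?Q => assert (E : L = L'); [|assert (0 <= Q)] end.
  + apply sum_eq. intros n _. now rewrite sum_n_Reals.
  + apply cond_pos_sum. intros k. apply cond_pos_sum. intros j.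
    apply Rmult_le_pos; apply Cmod_ge_0.
  + lra.
Qed.

(** * The negative binomial series *)

Lemma Binomial_C_diag (n : nat) : Binomial.C n n = 1.
Proof.
unfold Binomial.C. rewrite Nat.sub_diag. simpl.
field. apply INR_fact_neq_0.
Qed.

Lemma Binomial_C_0 (n : nat) : Binomial.C n 0 = 1.
Proof.
unfold Binomial.C. rewrite Nat.sub_0_r. simpl.
field. apply INR_fact_neq_0.
Qed.

(** The hockey-stick identity. *)
Lemma sum_Binomial_C_diagonal (s n : nat) :
  sum_n (fun k => Binomial.C (k + s) k) n = Binomial.C (n + S s) n.
Proof.
induction n as [|n IH].
- rewrite sum_O. now rewrite !Binomial_C_0.
- rewrite sum_Sn, IH. replace (S n + s)%nat with (n + S s)%nat by lia.
  apply pascal. lia.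
Qed.

Lemma RtoC_sum_n (c : nat -> R) (n : nat) :
  RtoC (sum_n c n) = @sum_n C_AbelianMonoid (fun k => RtoC (c k)) n.
Proof.
induction n as [|n IH]; [now rewrite !sum_O|].
rewrite !sum_Sn, <- IH. apply RtoC_plus.
Qed.

Lemma Cmod_geometric_abs (z : C) :
  Cmod z < 1 -> ex_series (fun n => Cmod (z ^ n)%C).
Proof.
intros Hz. exists (/ (1 - Cmod z)).
eapply is_series_ext; [|apply is_series_geom].
- intros n. simpl. now rewrite Cmod_pow.
- rewrite Rabs_pos_eq; [exact Hz|apply Cmod_ge_0].
Qed.

Lemma one_minus_neq0 (z : C) : Cmod z < 1 -> (1 - z)%C <> RtoC 0.
Proof.
intros Hz E. assert (Ez : z = RtoC 1) by (rewrite <- (Cplus_0_r z), <- E; ring).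
rewrite Ez, Cmod_1 in Hz. lra.
Qed.

(** The sum [l] of the series satisfies [l = 1 + z l]. *)
Lemma C_is_series_geom (z : C) :
  Cmod z < 1 -> C_is_series (fun n => (z ^ n)%C) (/ (1 - z))%C.
Proof.
intros Hz.
assert (E : exists l : C, C_is_series (fun n => (z ^ n)%C) l).
{ apply C_ex_series_dom with (2 := Cmod_geometric_abs z Hz). intros; lra. }
destruct E as [l Hl].
assert (H1 : C_is_series (fun n => (z ^ n)%C) (1 + z * l)%C).
{ apply is_series_decr_1.
  replace (plus _ _) with (z * l)%C by (unfold plus, opp; simpl; ring).
  exact (is_series_scal z _ _ Hl). }
assert (El : l = (1 + z * l)%C) by exact (filterlim_locally_unique _ _ _ Hl H1).
pose proof (one_minus_neq0 z Hz) as Nz.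
assert (E : (l * (1 - z))%C = RtoC 1).
{ replace (l * (1 - z))%C with (l - z * l)%C by ring. rewrite El at 1. ring. }
replace (/ (1 - z))%C with l; [exact Hl|].
transitivity (l * (1 - z) * / (1 - z))%C; [now field|now rewrite E, Cmult_1_l].
Qed.

(** Induction on [s]: multiplying by one more geometric series replaces the
    coefficients by their partial sums, which are again binomial by the
    hockey-stick identity. *)
Lemma negative_binomial_series (s : nat) (z : C) :
  Cmod z < 1 ->
  ex_series (fun m => Cmod (RtoC (Binomial.C (m + s) m) * z ^ m)%C) /\
  C_is_series (fun m => (RtoC (Binomial.C (m + s) m) * z ^ m)%C)
    (/ (1 - z) ^ S s)%C.
Proof.
intros Hz. pose proof (one_minus_neq0 z Hz) as Nz.
pose proof (Cmod_geometric_abs z Hz) as Ga. pose proof (C_is_series_geom z Hz) as G.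
induction s as [|s [IHa IH]].
- assert (E : forall m, (z ^ m)%C = (RtoC (Binomial.C (m + 0) m) * z ^ m)%C).
  { intros m. rewrite Nat.add_0_r, Binomial_C_diag. ring. }
  split.
  + eapply ex_series_ext; [|exact Ga]. intros m. simpl. now rewrite <- E.
  + simpl. rewrite Cmult_1_r. eapply is_series_ext; [|exact G].
    intros m. apply E.
- assert (E : forall m,
    fps_mult (fun k => (RtoC (Binomial.C (k + s) k) * z ^ k)%C) (fun k => (z ^ k)%C) m
    = (RtoC (Binomial.C (m + S s) m) * z ^ m)%C).
  { intros m. rewrite <- sum_Binomial_C_diagonal. unfold fps_mult.
    transitivity (@sum_n C_AbelianMonoid
                    (fun k => RtoC (Binomial.C (k + s) k) * z ^ m)%C m).
    - apply sum_n_ext_loc. intros k Hk.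
      rewrite <- Cmult_assoc, <- Cpow_add_r. do 2 f_equal. lia.
    - rewrite (@sum_n_mult_r C_Ring). now rewrite RtoC_sum_n. }
  split.
  + eapply ex_series_ext; [|apply (fps_mult_abs _ _ IHa Ga)].
    intros m. simpl. now rewrite E.
  + replace (/ (1 - z) ^ S (S s))%C with (/ (1 - z) ^ S s * / (1 - z))%C.
    * eapply is_series_ext; [|apply (fps_mult_series _ _ _ _ IHa Ga IH G)].
      intros m. apply E.
    * simpl. field. split; [|exact Nz]. apply Cpow_nz; exact Nz.
Qed.

(** * The generating function *)

(** Since [M_n! >= 1], the geometric series majorises [e_M^t]. *)
Lemma Cmod_e_M_coef_1_pow (t : C) (n : nat) :
  Cmod (e_M_coef 1 n * t ^ n)%C <= Cmod t ^ n.
Proof.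
rewrite Cmod_mult, Cmod_pow. rewrite <- (Rmult_1_l (Cmod t ^ n)) at 2.
apply Rmult_le_compat_r; [apply pow_le, Cmod_ge_0|apply Cmod_e_M_coef_1].
Qed.

Lemma sum_Cmod_e_M_pow_le (t : C) (m : nat) :
  Cmod t < 1 ->
  forall N, sum_n (fun n => Cmod (fps_pow (e_M_coef 1) m n * t ^ n)%C) N
            <= (/ (1 - Cmod t)) ^ m.
Proof.
intros Ht. pose proof (Cmod_ge_0 t) as Ht0.
induction m as [|m IH]; intros N.
- simpl pow. induction N as [|N IHN].
  + rewrite sum_O. simpl. rewrite Cmult_1_r, Cmod_1. lra.
  + rewrite sum_Sn. simpl. rewrite Cmult_0_l, Cmod_0.
    unfold plus; simpl. rewrite Rplus_0_r. exact IHN.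
- erewrite sum_n_ext.
  2:{ intros n. change (fps_pow (e_M_coef 1) (S m) n)
      with (fps_mult (e_M_coef 1) (fps_pow (e_M_coef 1) m) n).
      rewrite fps_mult_scale. reflexivity. }
  apply sum_Cmod_fps_mult_le; [|exact IH].
  clear N; intros N.
  eapply Rle_trans; [apply sum_n_le_R; intros k _; apply Cmod_e_M_coef_1_pow|].
  apply sum_n_le_series.
  + intros n. now apply pow_le.
  + apply is_series_geom. rewrite Rabs_pos_eq; lra.
Qed.

(** The bound is geometric in [m] with the constant [A] uniform in [m], so that
    it stays summable against [binom(m+s, m) lambda^m]. *)
Lemma sum_Cmod_trans_poly_le (x t : C) :
  Cmod t < 1 ->
  exists A, forall m N,
    sum_n (fun n => Cmod (trans_poly n m x * t ^ n / CMfact n)%C) N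
    <= A * (/ (1 - Cmod t)) ^ m.
Proof.
intros Ht. destruct (e_M_coef_abs x t) as [A HA].
assert (PA := sum_n_le_series _ A (fun n => Cmod_ge_0 _) HA).
exists A. intros m N.
erewrite sum_n_ext.
2:{ intros n. replace (trans_poly n m x * t ^ n / CMfact n)%C with
      (fps_mult (e_M_coef x) (fps_pow (e_M_coef 1) m) n * t ^ n)%C
      by (unfold trans_poly; field; apply CMfact_neq0).
    rewrite fps_mult_scale. reflexivity. }
apply sum_Cmod_fps_mult_le; [exact PA|now apply sum_Cmod_e_M_pow_le].
Qed.

Theorem theorem5p2 (r : nat) (x lambda : C)
  (hr : (1 <= r)%nat) (hlambda : (Cmod lambda < 1)%R) :
  exists U : C -> Prop,
    @locally C_UniformSpace (RtoC 0) U /\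
    forall t : C, U t ->
      (Cmod (lambda * e_M 1 t)%C < 1)%R /\
      @is_series C_AbsRing C_NormedModule
        (fun n : nat => (Phi r lambda n x * t ^ n / CMfact n)%C)
        (e_M x t / (1 - lambda * e_M 1 t) ^ r)%C.
Proof.
pose proof (Cmod_ge_0 lambda) as Hl0.
exists (fun t => Cmod t < 1 - Cmod lambda). split.
{ apply (@locally_le_locally_norm C_AbsRing C_NormedModule).
  assert (He : 0 < 1 - Cmod lambda) by lra.
  exists (mkposreal _ He). intros t Ht.
  unfold ball_norm, minus, plus, opp, norm in Ht; simpl in Ht.
  replace t with (t + - RtoC 0)%C by ring. exact Ht. }
intros t Ht. pose proof (Cmod_ge_0 t) as Ht0.
(* [B] majorises the absolute sum of the series [e_M^t]. *)
set (B := / (1 - Cmod t)).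
assert (HB0 : 0 < B) by (apply Rinv_0_lt_compat; lra).
assert (HlB : Cmod lambda * B < 1).
{ apply Rmult_lt_reg_r with (1 - Cmod t); [lra|].
  unfold B. rewrite Rmult_assoc, Rinv_l by lra. lra. }
assert (HE : Cmod (e_M 1 t) <= B).
{ apply (@norm_series_le C_AbsRing C_NormedModule _ _ _ _ (Cmod_e_M_coef_1_pow t)
           (e_M_is_series 1 t)).
  apply is_series_geom. rewrite Rabs_pos_eq; lra. }
assert (Hz : Cmod (lambda * e_M 1 t)%C < 1).
{ rewrite Cmod_mult. apply Rle_lt_trans with (2 := HlB).
  now apply Rmult_le_compat_l. }
split; [exact Hz|].
(* Writing [r = s + 1] removes the truncated subtraction from [m + r - 1]. *)
destruct r as [|s]; [lia|].
destruct (sum_Cmod_trans_poly_le x t ltac:(lra)) as [A HA].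
apply (@double_series_swap C_AbsRing C_CompleteNormedModule
  (fun m n => RtoC (Binomial.C (m + s) m) * lambda ^ m
              * (trans_poly n m x * t ^ n / CMfact n))%C
  (fun m => A * Cmod (RtoC (Binomial.C (m + s) m) * (RtoC (Cmod lambda * B)) ^ m)%C)
  (fun m => RtoC (Binomial.C (m + s) m) * lambda ^ m * (e_M x t * e_M 1 t ^ m))%C).
- intros m N.
  set (c := (RtoC (Binomial.C (m + s) m) * lambda ^ m)%C).
  rewrite (sum_n_ext _ (fun n => Cmod c *
             Cmod (trans_poly n m x * t ^ n / CMfact n)%C))
    by (intros n; unfold norm; simpl; apply Cmod_mult).
  rewrite (@sum_n_mult_l R_Ring). unfold mult; simpl.
  eapply Rle_trans; [apply Rmult_le_compat_l; [apply Cmod_ge_0|apply HA]|].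
  unfold c. rewrite !Cmod_mult, !Cmod_pow.
  rewrite (Cmod_R (Cmod lambda * B)), (Rabs_pos_eq (Cmod lambda * B)),
    Rpow_mult_distr by (apply Rmult_le_pos; lra).
  fold B. apply Req_le. ring.
- apply (@ex_series_scal_l R_AbsRing R_NormedModule A).
  apply negative_binomial_series.
  rewrite Cmod_R, Rabs_pos_eq; [exact HlB|apply Rmult_le_pos; lra].
- intros m. exact (is_series_scal _ _ _ (trans_poly_generating x t m)).
- intros n.
  assert (H := CSeries_correct _ (Phi_ex_series (S s) lambda n x hr hlambda)).
  apply (is_series_scal (t ^ n / CMfact n)%C) in H.
  replace (Phi (S s) lambda n x * t ^ n / CMfact n)%C with
    (scal (t ^ n / CMfact n)%C (CSeries (Phi_term (S s) lambda n x)))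
    by (unfold Phi, scal, Cdiv; simpl; unfold mult; simpl; ring).
  eapply is_series_ext; [|exact H].
  intros m. unfold Phi_term, scal; simpl; unfold mult; simpl.
  replace (m + S s - 1)%nat with (m + s)%nat by lia. unfold Cdiv. ring.
- replace (e_M x t / (1 - lambda * e_M 1 t) ^ S s)%C with
    (scal (e_M x t) (/ (1 - lambda * e_M 1 t) ^ S s)%C) by reflexivity.
  eapply is_series_ext;
    [|exact (is_series_scal _ _ _ (proj2 (negative_binomial_series s _ Hz)))].
  intros m. unfold scal; simpl; unfold mult; simpl.
  rewrite Cpow_mult_l. ring.
Qed.
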